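(* Let $S \subset \mathbb{F}_2^n$, let $\delta \in (0, 1/10]$ and $\tau > 1$ be such that $$|S| > \max\left(\frac{n^4(1+\tau)^4}{((\tau - \sqrt{\tau})\delta)^8},\, n^4\right)$$ and $$n \geq 20\left\lceil \log_2\left(\max\left(\frac{n(1+\tau)}{((\tau-\sqrt{\tau})\delta)^2},\, n\right)\right)\right\rceil.$$ Then there exists a natural number $$t \geq \log_2|S| - 4\log_2\left(\max\left(\frac{n(1+\tau)}{(\tau - \sqrt{\tau})^2\delta^2},\, n\right)\right)$$ such that at least a $(1-\delta)$-fraction of all surjective linear maps $L : \mathbb{F}_2^n \to \mathbb{F}_2^t$ have the property that $L(U_S)$ is $\tau 2^{-t}$-close to uniform in the $\ell_\infty$ norm, i.e. $|\Pr[L(U_S)=y] - 2^{-t}| \leq \tau 2^{-t}$ for all $y \in \mathbb{F}_2^t$.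
   Context: $U_S$ denotes a random variable distributed uniformly on the finite set $S$. A random variable $X$ on a finite set $Y$ is $\epsilon$-close to uniform in the $\ell_\infty$ norm if $|\Pr[X=y] - 1/|Y|| \leq \epsilon$ for every $y \in Y$. *)

(* Defs.v *)
From HB Require Import structures.
From mathcomp Require Import all_boot all_order all_algebra all_field.
From mathcomp Require Import all_classical all_reals.
From mathcomp Require Import exp.
Set Implicit Arguments. Unset Strict Implicit. Unset Printing Implicit Defensive.
Import Order.TTheory GRing.Theory Num.Theory.
Local Open Scope ring_scope.

Definition log2 {R : realType} (x : R) : R := ln x / ln 2.

(* Linear maps F_2^n -> F_2^t are represented by matrices M : 'M_(n,t),
   acting on row vectors: L(x) = x *m M. *)
Definition surjectiveb {n t : nat} (M : 'M['F_2]_(n, t)) : bool :=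
  [forall y : 'rV['F_2]_t, exists x : 'rV['F_2]_n, x *m M == y].

Definition prob_image {R : realType} {n t : nat} (S : {set 'rV['F_2]_n})
  (M : 'M['F_2]_(n, t)) (y : 'rV['F_2]_t) : R :=
  #|[set x in S | x *m M == y]|%:R / #|S|%:R.

Definition close_to_uniform {R : realType} {n t : nat} (S : {set 'rV['F_2]_n})
  (M : 'M['F_2]_(n, t)) (eps : R) : Prop :=
  forall y : 'rV['F_2]_t,
    `| prob_image S M y - 1 / (#|{: 'rV['F_2]_t}|%:R) | <= eps.

(* Main.v *)
Require Import Defs.
From HB Require Import structures.
From mathcomp Require Import all_boot all_order all_algebra all_field.
From mathcomp Require Import all_classical all_reals.
From mathcomp Require Import exp.
From mathcomp Require Import zify ring lra.
Import Order.TTheory GRing.Theory Num.Theory.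
Local Open Scope ring_scope.

(** Since [tau > 1], only heavy fibres have to be excluded.  Choose [t] minimal
    with [|S| <= 2^t m^4], where [m] is the maximum in the hypotheses, and [k]
    with [2n <= 2^k <= 4n].  Extend a random matrix [M : 'M_(n, t)] by [k]
    random columns to [N : 'M_(n, t + k)].  A fibre of [M] carrying more than
    [(1 + tau) |S| / 2^t] points of [S] is split by the new columns into [2^k]
    pieces, and pairwise independence makes all of them heavier than average
    with probability at least 1/2.  So if heavy fibres were likely, the set [T]
    of heavy points of [N] would often contain a whole coset of a [k]-dimensional
    space.  On the other hand [T] has small density by the second moment
    method; as [N] and [N G] are equidistributed for invertible [G], the
    direction of that coset may be taken random given [T], and a sparse set
    is unlikely to contain a coset of a random space of dimension about
    [log2 n]. *)

(** * Second moment of the fibre sizes of a random linear map *)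

Definition load {F : finFieldType} {n k : nat} (X : {set 'rV[F]_n})
  (W : 'M[F]_(n, k)) (z : 'rV[F]_k) : nat := #|[set x in X | x *m W == z]|.

(** [W0] is a section of [W |-> u *m W], and translation by [W0 v] identifies the annihilator of [u]
    with the fibre over [v]. With [u = x - x'] this gives the collision probability of two distinct
    points. *)
Lemma card_annihilator (F : finFieldType) (n k : nat) (u : 'rV[F]_n) :
  u != 0 ->
  (#|{: 'rV[F]_k}| * #|[set W : 'M[F]_(n, k) | u *m W == 0%R]| =
   #|{: 'M[F]_(n, k)}|)%N.
Proof.
move=> /rV0Pn[i ui0].
pose W0 (v : 'rV[F]_k) : 'M[F]_(n, k) := delta_mx i 0 *m ((u 0 i)^-1 *: v).
have uW0 v : u *m W0 v = v.
  rewrite /W0 mulmxA -colE [col i u]mx11_scalar mul_scalar_mx scalerA mxE.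
  by rewrite divff // scale1r.
rewrite -[RHS]sum1_card (partition_big (fun W => u *m W) xpredT) //=.
rewrite -sum_nat_const; apply: eq_bigr => v _.
rewrite (reindex_inj (addIr (W0 v))) /= -sum1_card; apply: eq_bigl => W.
by rewrite inE mulmxDr uW0 -[in RHS]subr_eq0 addrK.
Qed.

Lemma sum_load (F : finFieldType) (n k : nat) (X : {set 'rV[F]_n})
  (W : 'M[F]_(n, k)) : (\sum_z load X W z = #|X|)%N.
Proof.
rewrite -sum1_card (partition_big (fun x => x *m W) xpredT) //=.
by apply: eq_bigr => z _; rewrite /load -sum1_card; apply: eq_bigl => x; rewrite !inE.
Qed.

Lemma sum_load_sqr (F : finFieldType) (n k : nat) (X : {set 'rV[F]_n})
  (W : 'M[F]_(n, k)) :
  (\sum_z load X W z ^ 2 = \sum_(x in X) \sum_(x' in X) ((x - x') *m W == 0%R))%N.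
Proof.
rewrite [RHS](partition_big (fun x => x *m W) xpredT) //=.
apply: eq_bigr => z _; rewrite -mulnn {1}/load -sum1_card big_distrl /=.
apply: eq_big => [x|x]; rewrite !inE // mul1n => /andP[_ /eqP xz].
rewrite /load -sum1_card [RHS]big_mkcond /= big_mkcond /=.
apply: eq_bigr => x' _; rewrite !inE mulmxBl xz subr_eq0 eq_sym.
by case: (x' \in X).
Qed.

(** Pairs with [x = x'] collide under every [W]; by [card_annihilator] any other pair collides for a
    fraction [1 / #|{: 'rV[F]_k}|] of them. *)
Lemma load_collisions (F : finFieldType) (n k : nat) (X : {set 'rV[F]_n}) :
  (#|{: 'rV[F]_k}| * \sum_(W : 'M[F]_(n, k)) \sum_z load X W z ^ 2 <=
   (#|X| * #|{: 'rV[F]_k}| + #|X| * #|X|) * #|{: 'M[F]_(n, k)}|)%N.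
Proof.
under eq_bigr do rewrite sum_load_sqr.
rewrite exchange_big /= big_distrr /=.
rewrite -mulnDr -mulnA -sum_nat_const; apply: leq_sum => x xX.
rewrite exchange_big /= big_distrr /= (bigD1 x) //= mulnDl; apply: leq_add.
  rewrite leq_mul2l; apply/orP; right.
  apply: leq_trans (_ : \sum_(W : 'M[F]_(n, k)) 1 <= _)%N.
    by apply: leq_sum => W _; case: eqP.
  by rewrite sum1_card; apply: max_card.
rewrite -sum_nat_const [leqRHS](bigD1 x) //=; apply: leq_trans (leq_addl _ _).
apply: leq_sum => x' /andP[_ xx'].
rewrite -(@card_annihilator F n k (x - x')) ?subr_eq0 1?eq_sym //.
rewrite leq_mul2l -sum1_card [leqRHS]big_mkcond /=; apply/orP; right.
by apply: leq_sum => W _; rewrite inE; case: eqP.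
Qed.

(** Expanding the square reduces this to [load_collisions]. The deviations are summed over all cells
    [z], which later avoids a union bound over [z]. *)
Lemma load_second_moment (R : realFieldType) (F : finFieldType) (n k : nat)
  (X : {set 'rV[F]_n}) :
  \sum_(W : 'M[F]_(n, k)) \sum_z
     ((load X W z)%:R - #|X|%:R / #|{: 'rV[F]_k}|%:R) ^+ 2 <=
  #|X|%:R * #|{: 'M[F]_(n, k)}|%:R :> R.
Proof.
set K := #|{: 'rV[F]_k}|; set N := #|{: 'M[F]_(n, k)}|.
have K0 : 0 < K%:R :> R by rewrite ltr0n; apply/card_gt0P; exists 0.
have step (W : 'M[F]_(n, k)) : \sum_z ((load X W z)%:R - #|X|%:R / K%:R) ^+ 2 =
    (\sum_z load X W z ^ 2)%:R - #|X|%:R ^+ 2 / K%:R :> R.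
  transitivity (\sum_z ((load X W z ^ 2)%:R - 2 * (#|X|%:R / K%:R) * (load X W z)%:R
        + (#|X|%:R / K%:R) ^+ 2) : R).
    by apply: eq_bigr => z _; rewrite natrX; ring.
  rewrite big_split sumrB /= -mulr_sumr -!natr_sum sum_load sumr_const.
  rewrite -[X in _ + X = _]mulr_natr -/K; field.
  by rewrite gt_eqF.
under eq_bigr do rewrite step.
rewrite sumrB -natr_sum sumr_const -[X in _ - X <= _]mulr_natr -/N.
have := @load_collisions F n k X; rewrite -/K -/N -(ler_nat R) !natrM natrD !natrM.
move=> H; rewrite -(ler_pM2l K0).
apply: le_trans (_ : _ <= (#|X|%:R * K%:R + #|X|%:R * #|X|%:R) * N%:R
                          - #|X|%:R ^+ 2 * N%:R) _; last first.
  by rewrite le_eqVlt; apply/orP; left; apply/eqP; ring.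
rewrite mulrBr lerB //.
have -> // : K%:R * (#|X|%:R ^+ 2 / K%:R * N%:R) = #|X|%:R ^+ 2 * N%:R :> R.
by field; rewrite gt_eqF.
Qed.

(** * Cosets of random subspaces inside sparse sets *)

(* The density of [T :&: (T - v)] averages to the square of the density of [T]
   over a uniform [v]; capping the resulting bound by the trivial probability
   bound 1 gains a square root, so that [b] is replaced by [b ^+ 2] at each
   dimension. *)
Lemma card_coset_subset (R : realFieldType) (F : finFieldType) (k s : nat)
  (T : {set 'rV[F]_s}) (b : R) : 0 <= b ->
  #|{: 'rV[F]_s}|%:R <= b ^+ (2 ^ k) ->
  #|[set V : 'M[F]_(k, s) |
      [exists u, [forall z : 'rV_k, u + z *m V \in T]]]|%:R * #|{: 'rV[F]_s}|%:R
  <= b * #|T|%:R * #|{: 'rV[F]_s}|%:R ^+ k.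
Proof.
set Q := #|{: 'rV[F]_s}|; have Q1 : 1 <= Q%:R :> R.
  by rewrite ler1n; apply/card_gt0P; exists 0.
elim: k T b => [|k IH] T b b0.
  rewrite expn0 expr1 expr0 mulr1 => Qb.
  have [->|[x xT]] := set_0Vmem T.
    rewrite (_ : [set _ | _] = finset.set0) ?finset.cards0 ?mul0r ?mulr0 //.
    apply/finset.setP => V; rewrite !inE; apply/negbTE/negP => /fintype.existsP[u /fintype.forallP/(_ 0)].
    by rewrite inE.
  rewrite mulrC ler_pM ?ler0n //.
  apply: le_trans (_ : 1 <= _); last first.
    by rewrite ler1n; apply/card_gt0P; exists x.
  rewrite lern1; apply: leq_trans (max_card _) _.
  by rewrite card_mx mul0n.
move=> Qb; pose Tv (v : 'rV[F]_s) := [set x in T | x + v \in T].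
have sumTv : (\sum_v #|Tv v| = #|T| * #|T|)%N.
  transitivity (\sum_(x in T) \sum_v ((x + v)%R \in T))%N.
    rewrite exchange_big; apply: eq_bigr => v _ /=.
    rewrite -sum1_card big_mkcond [RHS]big_mkcond; apply: eq_bigr => x _ /=.
    by rewrite inE; case: (x \in T); case: (_ \in T).
  rewrite -sum_nat_const; apply: eq_bigr => x _.
  rewrite (reindex_inj (addrI (- x))) -sum1_card [RHS]big_mkcond; apply: eq_bigr => v _ /=.
  by rewrite addNKr.
pose P k (T : {set 'rV[F]_s}) (V : 'M[F]_(k, s)) :=
  [exists u, [forall z : 'rV_k, u + z *m V \in T]].
(* Split off the first row [v] of the matrix: coefficients 0 and 1 on [v] show that the coset of the
   row space of the remaining rows lies in both [T] and [T - v]. *)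
have cardP : (#|[set V | P k.+1 T V]| <= \sum_v #|[set V | P k (Tv v) V]|)%N.
  rewrite -sum1_card (reindex (fun p : 'rV[F]_s * 'M[F]_(k, s) => col_mx p.1 p.2 : 'M_(k.+1, s))) /=; last first.
    exists (fun V : 'M_(1 + k, s) => (usubmx V, dsubmx V)) => [[v V] _|V _] /=.
      by rewrite col_mxKu col_mxKd.
    by rewrite vsubmxK.
  under [leqRHS]eq_bigr do rewrite -sum1_card.
  rewrite pair_big_dep /= big_mkcond [leqRHS]big_mkcond /=; apply: leq_sum => -[v V] _ /=.
  rewrite !inE; case: ifP => // /fintype.existsP[u /fintype.forallP uT].
  rewrite (_ : P k _ _) //; apply/fintype.existsP; exists u; apply/fintype.forallP => z.
  rewrite inE; apply/andP; split.
    have := uT (row_mx 0 z : 'rV_(1 + k)).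
    by rewrite (mul_row_col 0 z v V) mul0mx add0r.
  have := uT (row_mx 1%:M z : 'rV_(1 + k)).
  by rewrite (mul_row_col 1%:M z v V) mul1mx addrCA addrC.
have b2 : Q%:R <= (b ^+ 2) ^+ (2 ^ k) by rewrite -exprM -expnS.
have main : #|[set V | P k.+1 T V]|%:R * Q%:R <= b ^+ 2 * #|T|%:R ^+ 2 * Q%:R ^+ k :> R.
  apply: le_trans (_ : (\sum_v #|[set V | P k (Tv v) V]|)%:R * Q%:R <= _).
    by rewrite ler_wpM2r ?ler0n // ler_nat.
  rewrite natr_sum mulr_suml (expr2 #|T|%:R) -natrM -sumTv natr_sum.
  rewrite mulr_sumr mulr_suml; apply: ler_sum => v _.
  by apply: IH => //; rewrite exprn_ge0.
have triv : #|[set V | P k.+1 T V]|%:R <= Q%:R * Q%:R ^+ k :> R.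
  rewrite -exprS -natrX ler_nat; apply: leq_trans (max_card _) _.
  by rewrite /Q !card_mx mul1n -expnM mulnC.
have Qk0 : 0 <= Q%:R ^+ k :> R by rewrite exprn_ge0 ?ler0n.
rewrite -/(P _ _) exprS mulrA -/(P k.+1 T); move: main triv.
set x := #|_|%:R; set y := #|T|%:R; set z := _ ^+ k in Qk0 *.
have x0 : 0 <= x by apply: ler0n.
have y0 : 0 <= y by apply: ler0n.
move=> main triv; have [bt|/ltW bt] := leP Q%:R (b * y).
  apply: le_trans (_ : _ <= Q%:R * z * Q%:R) _.
    by rewrite ler_wpM2r ?ler0n.
  by rewrite mulrAC ler_wpM2r // ler_wpM2r ?ler0n.
apply: le_trans main _; rewrite ler_wpM2r // -exprMn expr2.
by rewrite ler_wpM2l // mulr_ge0.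
Qed.

(** * Proportion of invertible and of surjective matrices *)

Lemma card_unitmx_ge (F : finFieldType) (n : nat) :
  (#|{: 'M[F]_n}| <= 4 * #|[set A : 'M[F]_n | A \in unitmx]|)%N.
Proof.
case: n => [|n].
  rewrite card_mx mul0n expn0 muln_gt0; apply/card_gt0P; exists 1%:M.
  by rewrite inE unitmx1.
have -> : #|[set A : 'M[F]_n.+1 | A \in unitmx]| = #|'GL_n.+1[F]%g|.
  by rewrite [RHS]cardsT /= card_sub; apply: eq_card => A; rewrite inE.
rewrite card_mx card_GL //; set q := #|F|.
have q2 : (1 < q)%N by apply: finNzRing_gt1.
have -> : (n.+1 * n.+1 = 'C(n.+1, 2) + 'C(n.+2, 2))%N.
  by rewrite [X in (_ + X)%N]binS bin1; have := mul_bin_diag n.+1 1; rewrite bin1 /=; nia.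
rewrite expnD mulnCA leq_mul2l; apply/orP; right.
set D := (_ ^ _)%N; set P := \prod_(_ <= _ < _) _.
(* Strengthened for induction to [P / D >= 1/4 + q ^- n.+2]: equality holds for [q = 2] and size 1,
   and the surplus pays for the next factor [1 - q ^- n.+2]. *)
suff H : (D * (q ^ n.+2 + 4) <= 4 * P * q ^ n.+2)%N.
  have Y0 : (0 < q ^ n.+2)%N by rewrite expn_gt0 ltnW.
  by rewrite -(leq_pmul2r Y0); apply: leq_trans H; rewrite mulnDr leq_addr.
rewrite {}/D {}/P; elim: n => [|n IH].
  by rewrite big_nat1 binn !expn1 !expnS expn0 !muln1; nia.
rewrite big_nat_recr //= binS bin1 [X in (X * _ <= _)%N]expnD.
move: IH; rewrite [(q ^ n.+3)%N]expnS.
have Y4 : (4 <= q ^ n.+2)%N.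
  have : (0 < q ^ n)%N by rewrite expn_gt0 ltnW.
  by rewrite !expnS; nia.
move: Y4; set Y := (q ^ n.+2)%N; set D := (q ^ _)%N; set P := \prod_(_ <= _ < _) _.
clearbody Y D P => Y4 IH.
have e1 : ((Y + 4) * ((Y - 1) * q) >= Y * (q * Y + 4))%N by nia.
apply: leq_trans (_ : D * (Y + 4) * ((Y - 1) * q) <= _)%N.
  by rewrite -!mulnA leq_mul2l e1 orbT.
apply: leq_trans (leq_mul IH (leqnn _)) _.
rewrite -[(P * (Y - 1)%N)%R]/(P * (Y - 1))%N -!mulnA leq_mul2l; apply/orP; right.
by rewrite leq_mul2l mulnCA mulnA [(q * _)%N]mulnC mulnA leqnn orbT.
Qed.

Lemma sum_row_mx (F : finFieldType) (V : nmodType) (n t k : nat)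
  (f : 'M[F]_(n, t + k) -> V) :
  \sum_N f N = \sum_M \sum_W f (row_mx M W).
Proof.
rewrite pair_big (reindex (fun p => row_mx p.1 p.2)) //=.
exists (fun N => (lsubmx N, rsubmx N)) => [[M W] _|N _] /=.
  by rewrite row_mxKl row_mxKr.
by rewrite hsubmxK.
Qed.

Lemma sum_col_mx (F : finFieldType) (V : nmodType) (t k n : nat)
  (f : 'M[F]_(t + k, n) -> V) :
  \sum_N f N = \sum_M \sum_W f (col_mx M W).
Proof.
rewrite pair_big (reindex (fun p => col_mx p.1 p.2)) //=.
exists (fun N => (usubmx N, dsubmx N)) => [[M W] _|N _] /=.
  by rewrite col_mxKu col_mxKd.
by rewrite vsubmxK.
Qed.

(** The first [t] columns of an invertible matrix define a surjective map, so invertible matrices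
    are among the completions of surjective ones. *)
Lemma card_surjective_ge (n t : nat) : (t <= n)%N ->
  (#|{: 'M['F_2]_(n, t)}| <= 4 * #|[set M : 'M['F_2]_(n, t) | surjectiveb M]|)%N.
Proof.
move=> /subnKC <-; set r := (n - t)%N.
have r0 : (0 < #|{: 'M['F_2]_(t + r, r)}|)%N by apply/card_gt0P; exists 0.
rewrite -(leq_pmul2r r0) [X in (X <= _)%N](_ : _ = #|{: 'M['F_2]_(t + r)}|); last first.
  by rewrite !card_mx -expnD -mulnDr.
apply: leq_trans (@card_unitmx_ge 'F_2 (t + r)) _.
rewrite -mulnA leq_mul2l -sum1_card big_mkcond /=.
rewrite (@sum_row_mx _ nat) -[in leqRHS]sum1_card [in leqRHS]big_mkcond big_distrl /=.
apply: leq_sum => M _; rewrite inE; case: ifP => Msurj.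
  rewrite mul1n -sum1_card; apply: leq_sum => W _; by case: ifP.
rewrite mul0n leqn0 sum_nat_eq0; apply/fintype.forallP => W; apply/implyP => _.
rewrite inE; case: ifP => // MW; move/negP: Msurj; case.
apply/fintype.forallP => y; apply/fintype.existsP; exists (row_mx y 0 *m invmx (row_mx M W)).
have := mulmxKV MW (row_mx y 0); rewrite [X in X = _](mul_mx_row _ M W).
by case/eq_row_mx => -> _.
Qed.

(** * Heavy points and heavy cosets of the extended map *)

(** The points [row_mx y z] with [y] fixed index the cells into which the last [k] columns cut the
    fibre of [lsubmx N] over [y]. *)
Definition has_heavy_coset {R : realFieldType} {F : finFieldType} {n t k : nat}
  (S : {set 'rV[F]_n}) (c : R) (N : 'M[F]_(n, t + k)) : bool :=
  [exists y : 'rV_t, [forall z : 'rV_k, c <= (load S N (row_mx y z))%:R]].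

Definition heavy_points {R : realFieldType} {F : finFieldType} {n s : nat}
  (S : {set 'rV[F]_n}) (c : R) (N : 'M[F]_(n, s)) : {set 'rV[F]_s} :=
  [set w | c <= (load S N w)%:R].

Lemma load_mul_unit (F : finFieldType) (n s : nat) (S : {set 'rV[F]_n})
  (N : 'M[F]_(n, s)) (G : 'M[F]_s) (w : 'rV[F]_s) : G \in unitmx ->
  load S (N *m G) w = load S N (w *m invmx G).
Proof.
move=> uG; rewrite /load; apply: eq_card => x; rewrite !inE; congr (_ && _).
rewrite mulmxA; apply/eqP/eqP => [<-|->]; first by rewrite mulmxK.
by rewrite mulmxKV.
Qed.

(* [N] is replaced by [N *m G] with [G] invertible, and [invmx G] is then relaxed
   to an arbitrary matrix at the cost of the factor 4 of [card_unitmx_ge]. *)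
Lemma card_has_heavy_coset (R : realFieldType) (F : finFieldType) (n t k : nat)
  (S : {set 'rV[F]_n}) (b c : R) :
  0 <= b -> #|{: 'rV[F]_(t + k)}|%:R <= b ^+ (2 ^ k) ->
  #|[set N : 'M[F]_(n, t + k) | has_heavy_coset S c N]|%:R
    * #|{: 'rV[F]_(t + k)}|%:R <=
  4 * b * (\sum_(N : 'M[F]_(n, t + k)) #|heavy_points S c N|)%:R.
Proof.
move=> b0 Qb; set Q := #|{: 'rV[F]_(t + k)}|.
pose U := [set G : 'M[F]_(t + k) | G \in unitmx].
pose P (T : {set 'rV[F]_(t + k)}) (V : 'M[F]_(k, t + k)) := [exists u, [forall z : 'rV_k, u + z *m V \in T]].
have U0 : 0 < #|U|%:R :> R.
  by rewrite ltr0n; apply/card_gt0P; exists 1%:M; rewrite inE unitmx1.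
have U4 : #|{: 'M[F]_(t + k)}|%:R <= 4 * #|U|%:R :> R.
  by rewrite -natrM ler_nat card_unitmx_ge.
have sym : (#|U| * #|[set N : 'M[F]_(n, t + k) | has_heavy_coset S c N]| <=
    \sum_(N : 'M[F]_(n, t + k))
       #|{: 'M[F]_(t, t + k)}| * #|[set V | P (heavy_points S c N) V]|)%N.
  rewrite -sum_nat_const.
  apply: leq_trans (_ : \sum_(G in U) \sum_(N : 'M[F]_(n, t + k))
                          P (heavy_points S c N) (dsubmx (invmx G)) <= _)%N.
    apply: leq_sum => G; rewrite inE => uG.
    have injG : injective (fun N : 'M[F]_(n, t + k) => N *m G).
      by move=> A B /(congr1 (mulmx^~ (invmx G))); rewrite !mulmxK.
    rewrite -sum1_card big_mkcond (reindex_inj injG) /=.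
    apply: leq_sum => N _; rewrite inE; case: ifP => // /fintype.existsP[y /fintype.forallP yT].
    (* A heavy coset of [N *m G] pulls back to one of [N] whose direction is spanned by the last [k]
       rows of [invmx G]. *)
    rewrite (_ : P _ _) //; apply/fintype.existsP; exists (y *m usubmx (invmx G)).
    apply/fintype.forallP => z; rewrite inE -mul_row_col vsubmxK.
    by rewrite -load_mul_unit.
  rewrite exchange_big /=; apply: leq_sum => N _.
  (* [invmx] is an involution on all matrices, as it fixes the singular ones. *)
  rewrite (reindex_inj (can_inj (@invmxK F (t + k)))) /=.
  under eq_bigr do rewrite invmxK.
  apply: leq_trans (_ : \sum_(G : 'M[F]_(t + k)) P (heavy_points S c N) (dsubmx G) <= _)%N.
    rewrite big_mkcond; apply: leq_sum => G _; by case: ifP.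
  rewrite (@sum_col_mx _ nat) -sum1_card big_distrl /=; apply: leq_sum => M _.
  rewrite mul1n -sum1_card [leqRHS]big_mkcond; apply: leq_sum => V _ /=.
  by rewrite col_mxKd inE; case: ifP.
rewrite -(ler_pM2l U0) mulrA.
apply: le_trans (_ : (\sum_(N : 'M[F]_(n, t + k)) #|{: 'M[F]_(t, t + k)}| * #|[set V | P (heavy_points S c N) V]|)%:R * Q%:R <= _).
  by rewrite ler_wpM2r // -natrM ler_nat.
apply: le_trans (_ : b * #|{: 'M[F]_(t + k)}|%:R * (\sum_(N : 'M[F]_(n, t + k)) #|heavy_points S c N|)%:R <= _).
  rewrite !natr_sum mulr_suml mulr_sumr; apply: ler_sum => N _.
  have -> : #|{: 'M[F]_(t + k)}| = (#|{: 'M[F]_(t, t + k)}| * Q ^ k)%N.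
    by rewrite /Q !card_mx mul1n -expnM -expnD mulnDl [(k * _)%N]mulnC.
  have := @card_coset_subset R F k (t + k) (heavy_points S c N) b b0 Qb.
  rewrite -/Q -/(P _) !natrM natrX => H; rewrite -mulrA.
  apply: le_trans (ler_wpM2l (ler0n R _) H) _.
  by rewrite le_eqVlt; apply/orP; left; apply/eqP; ring.
have b' : 0 <= b * (\sum_(N : 'M[F]_(n, t + k)) #|heavy_points S c N|)%:R.
  by rewrite mulr_ge0.
have := ler_wpM2l b' U4; lra.
Qed.

(** Chebyshev: each heavy point contributes at least [(c - #|S| / #|{: 'rV[F]_s}|) ^ 2] to the
    second moment. *)
Lemma sum_heavy_points (R : realFieldType) (F : finFieldType) (n s : nat)
  (S : {set 'rV[F]_n}) (c : R) :
  #|S|%:R / #|{: 'rV[F]_s}|%:R <= c ->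
  (\sum_(N : 'M[F]_(n, s)) #|heavy_points S c N|)%:R
    * (c - #|S|%:R / #|{: 'rV[F]_s}|%:R) ^+ 2
  <= #|S|%:R * #|{: 'M[F]_(n, s)}|%:R.
Proof.
move=> cA; apply: le_trans (load_second_moment R F n s S).
rewrite natr_sum mulr_suml; apply: ler_sum => N _.
rewrite mulr_natl -sumr_const big_mkcond /=; apply: ler_sum => w _.
rewrite inE; case: ifP => [cw|_]; last exact: sqr_ge0.
by rewrite lerXn2r ?nnegrE ?subr_ge0 ?lerB // (le_trans cA).
Qed.

(** * Splitting a heavy fibre into heavy cells *)

(** A single cell below [c] already contributes the squared gap to the second moment over all
    cells. *)
Lemma card_unbalanced (R : realFieldType) (F : finFieldType) (n k : nat)
  (X : {set 'rV[F]_n}) (c : R) :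
  c <= #|X|%:R / #|{: 'rV[F]_k}|%:R ->
  #|[set W : 'M[F]_(n, k) | [exists z, (load X W z)%:R < c]]|%:R
    * (#|X|%:R / #|{: 'rV[F]_k}|%:R - c) ^+ 2
  <= #|X|%:R * #|{: 'M[F]_(n, k)}|%:R.
Proof.
move=> cA; apply: le_trans (load_second_moment R F n k X).
rewrite mulr_natl -sumr_const big_mkcond /=; apply: ler_sum => W _.
rewrite inE; case: ifP => [/fintype.existsP[z zc]|_]; last first.
  by apply: sumr_ge0 => z _; apply: sqr_ge0.
rewrite (bigD1 z) //= -[leLHS]addr0 lerD ?sumr_ge0 // => [|w _]; last exact: sqr_ge0.
rewrite -[leRHS]sqrrN opprB lerXn2r ?nnegrE ?subr_ge0 ?lerB //.
- by rewrite ltW // (lt_le_trans zc).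
- by rewrite ltW.
Qed.

Lemma load_row_mx (F : finFieldType) (n t k : nat) (S : {set 'rV[F]_n})
  (M : 'M[F]_(n, t)) (W : 'M[F]_(n, k)) (y : 'rV[F]_t) (z : 'rV[F]_k) :
  load S (row_mx M W) (row_mx y z) = load [set x in S | x *m M == y] W z.
Proof.
apply: eq_card => x; rewrite !inE -andbA; congr (_ && _); rewrite mul_mx_row.
by apply/eqP/andP => [/eq_row_mx[-> ->]|[/eqP-> /eqP->]].
Qed.

(** The condition on [B] makes [card_unbalanced] apply to a fibre of size [B]: at most half of the
    extensions [W] leave one of its cells below [c], and the others give [row_mx M W] a heavy
    coset. *)
Lemma card_heavy_fibre_le (R : realFieldType) (F : finFieldType) (n t k : nat)
  (S : {set 'rV[F]_n}) (c beta : R) :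
  (forall B, beta < B -> c <= B / #|{: 'rV[F]_k}|%:R /\
                   2 * B <= (B / #|{: 'rV[F]_k}|%:R - c) ^+ 2) ->
  0 <= beta ->
  (#|[set M : 'M[F]_(n, t) | [exists y, (beta < (load S M y)%:R)%R]]|
    * #|{: 'M[F]_(n, k)}| <=
  2 * #|[set N : 'M[F]_(n, t + k) | has_heavy_coset S c N]|)%N.
Proof.
move=> Hb beta0; rewrite -sum_nat_const -[in leqRHS]sum1_card [in leqRHS]big_mkcond /=.
rewrite (@sum_row_mx _ nat) big_mkcond big_distrr /=.
apply: leq_sum => M _; rewrite inE; case: ifP => // /fintype.existsP[y yM].
pose X := [set x in S | x *m M == y].
have [c1 c2] := Hb _ yM.
have := @card_unbalanced R F n k X c c1; rewrite -[#|X|]/(load S M y).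
set bad := [set W | _] => H.
have B0 : 0 < (load S M y)%:R :> R by apply: le_lt_trans yM.
have H2 : (2 * #|bad| <= #|{: 'M[F]_(n, k)}|)%N.
  rewrite -(ler_nat R) natrM -(ler_pM2l B0); apply: le_trans H.
  have := ler_wpM2l (ler0n R #|bad|) c2; lra.
have H3 : (#|~: bad| <= \sum_(W : 'M[F]_(n, k)) if row_mx M W \in [set N | has_heavy_coset S c N] then 1 else 0)%N.
  rewrite -sum1_card big_mkcond; apply: leq_sum => W _.
  rewrite !inE; case: ifP => // Wgood; rewrite ifT //.
  apply/fintype.existsP; exists y; apply/fintype.forallP => z; rewrite load_row_mx.
  rewrite leNgt; apply/negP => zc; move/negP: Wgood; apply.
  by apply/fintype.existsP; exists z.
have cN : (#|bad| + #|~: bad| = #|{: 'M[F]_(n, k)}|)%N := cardsC bad.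
apply: leq_trans (_ : 2 * #|~: bad| <= _)%N; last by rewrite leq_mul2l.
by move: H2 cN; clear; lia.
Qed.

(** Heavy fibres yield heavy cosets (factor 2), heavy cosets are bounded by heavy points (factor
    [4 * b]), and heavy points by the second moment. *)
Lemma card_heavy_fibre (R : realFieldType) (F : finFieldType) (n t k : nat)
  (S : {set 'rV[F]_n}) (b c beta : R) :
  0 <= b -> #|{: 'rV[F]_(t + k)}|%:R <= b ^+ (2 ^ k) ->
  #|S|%:R / #|{: 'rV[F]_(t + k)}|%:R <= c ->
  0 <= beta ->
  (forall B, beta < B -> c <= B / #|{: 'rV[F]_k}|%:R /\
                   2 * B <= (B / #|{: 'rV[F]_k}|%:R - c) ^+ 2) ->
  #|[set M : 'M[F]_(n, t) | [exists y, beta < (load S M y)%:R]]|%:R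
    * (c - #|S|%:R / #|{: 'rV[F]_(t + k)}|%:R) ^+ 2 <=
  8 * b * (#|S|%:R / #|{: 'rV[F]_(t + k)}|%:R) * #|{: 'M[F]_(n, t)}|%:R.
Proof.
move=> b0 Qb cA beta0 Hb.
have := @card_heavy_fibre_le R F n t k S c beta Hb beta0.
have := @card_has_heavy_coset R F n t k S b c b0 Qb.
have := @sum_heavy_points R F n (t + k) S c cA.
rewrite -(ler_nat R) !natrM.
have -> : #|{: 'M[F]_(n, t + k)}| = (#|{: 'M[F]_(n, t)}| * #|{: 'M[F]_(n, k)}|)%N.
  by rewrite !card_mx mulnDr expnD.
rewrite natrM.
have : 0 < #|{: 'M[F]_(n, k)}|%:R :> R by rewrite ltr0n; apply/card_gt0P; exists 0.
have : 0 < #|{: 'rV[F]_(t + k)}|%:R :> R by rewrite ltr0n; apply/card_gt0P; exists 0.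
set Q := #|{: 'rV[F]_(t + k)}|%:R; set Mk := #|{: 'M[F]_(n, k)}|%:R; set Mt := #|{: 'M[F]_(n, t)}|%:R.
set Sg := (\sum_N _)%:R; set Ev := #|[set _ | has_heavy_coset _ _ _]|%:R; set H := #|[set _ | _]|%:R.
set d := (c - _) ^+ 2 => Q0 Mk0 h1 h2 h3.
have d0 : 0 <= d by apply: sqr_ge0.
rewrite -(ler_pM2l Mk0) -(ler_pM2l Q0).
have -> : Q * (Mk * (8 * b * (#|S|%:R / Q) * Mt)) = 8 * b * (#|S|%:R * (Mt * Mk)).
  by field; rewrite gt_eqF.
apply: le_trans (_ : 8 * b * (Sg * d) <= _); last first.
  by apply: ler_wpM2l h1; rewrite mulr_ge0.
apply: le_trans (_ : 2 * (Ev * Q) * d <= _); last first.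
  have := ler_wpM2r d0 h2; lra.
have Qd0 : 0 <= Q * d by apply: mulr_ge0 => //; apply: ltW.
have := ler_wpM2r Qd0 h3; lra.
Qed.

(** * The binary field, logarithms and numerical parameters *)

Lemma card_rV_F2 (t : nat) : #|{: 'rV['F_2]_t}| = (2 ^ t)%N.
Proof. by rewrite card_mx card_Fp // mul1n. Qed.

(* Since [1 <= tau], the lower bound on the probabilities is vacuous. *)
Lemma close_to_uniform_load (R : realType) (n t : nat) (S : {set 'rV['F_2]_n})
  (M : 'M['F_2]_(n, t)) (tau : R) :
  1 <= tau -> (0 < #|S|)%N ->
  (forall y, (load S M y)%:R <= (1 + tau) * (#|S|%:R / 2 ^+ t)) ->
  close_to_uniform S M (tau * 2 ^- t).
Proof.
move=> tau1 S0 H y; rewrite /prob_image card_rV_F2 natrX div1r -/(load S M y).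
have S0' : 0 < #|S|%:R :> R by rewrite ltr0n.
have e0 : 0 < 2 ^- t :> R by rewrite invr_gt0 exprn_gt0.
have p0 : 0 <= (load S M y)%:R / #|S|%:R :> R by rewrite divr_ge0.
have p1 : (load S M y)%:R / #|S|%:R <= (1 + tau) * 2 ^- t.
  by rewrite ler_pdivrMr // mulrAC -mulrA H.
have := ler_wpM2r (ltW e0) tau1.
by rewrite ler_norml; move=> ?; apply/andP; split; lra.
Qed.

Lemma load_le_card (F : finFieldType) (n k : nat) (X : {set 'rV[F]_n})
  (W : 'M[F]_(n, k)) (z : 'rV[F]_k) : (load X W z <= #|X|)%N.
Proof. by apply/subset_leq_card/fintype.subsetP => x; rewrite inE => /andP[]. Qed.

Lemma log2_ge0 (R : realType) (x : R) : 1 <= x -> 0 <= log2 x.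
Proof. by move=> x1; rewrite divr_ge0 ?ln_ge0 // ler1n. Qed.

Lemma log2_le_nat (R : realType) (x : R) (t : nat) :
  0 < x -> x <= 2 ^+ t -> log2 x <= t%:R.
Proof.
move=> x0 xt; have l2 : 0 < ln 2 :> R by rewrite ln_gt0 // ltr1n.
rewrite ler_pdivrMr // mulr_natl -lnXn ?ltr0n // ler_ln ?posrE //.
by rewrite exprn_gt0.
Qed.

Lemma log2_gt_nat (R : realType) (x : R) (j : nat) : 2 ^+ j < x -> j%:R < log2 x.
Proof.
move=> xj; have l2 : 0 < ln 2 :> R by rewrite ln_gt0 // ltr1n.
have j0 : 0 < 2 ^+ j :> R by rewrite exprn_gt0.
by rewrite ltr_pdivlMr // mulr_natl -lnXn ?ltr0n // ltr_ln ?posrE // (lt_trans j0).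
Qed.

(* [n >= 2] gives [n >= 20], which in turn gives [n >= 100]. *)
Lemma bootstrap_n_ge100 (R : realType) (n : nat) (m : R) :
  (1 < n)%N -> n%:R <= m -> 20 * (Num.ceil (log2 m))%:~R <= n%:R :> R ->
  100 <= n%:R :> R.
Proof.
move=> n2 nm Hn.
have step (j : nat) : (2 ^ j < n)%N -> 20 * j.+1%:R <= n%:R :> R.
  move=> jn; apply: le_trans Hn; rewrite ler_pM2l // -[j.+1%:R]/((j.+1%:Z)%:~R).
  rewrite ler_int -ltzD1 -addn1 PoszD ltrD2r -(ltr_int R).
  apply: lt_le_trans (ceil_ge _); apply: log2_gt_nat.
  by apply: lt_le_trans nm; rewrite -natrX ltr_nat.
have n20 : (20 <= n)%N by have := step 0 n2; rewrite -natrM ler_nat.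
have n100 := step 4 (leq_trans _ n20).
by apply: le_trans (n100 _) => //; rewrite -natrM ler_nat.
Qed.

(** [A] is the average fibre size, [K] the number of cells per fibre, [B] the size of a heavy fibre.
    The threshold [(1 + tau / 2) * (A / K)] lies midway between [A / K] and [(1 + tau) * (A / K)].
    The first conclusion feeds [card_heavy_fibre]; the second makes the resulting bound small. *)
Lemma parameter_estimates (R : realFieldType) (n m tau a delta A K B : R) :
  100 <= n -> n <= m -> 1 < tau -> 0 < a -> a <= tau ->
  0 < delta -> delta <= 1 / 10 -> n * (1 + tau) / (a * delta) ^+ 2 <= m ->
  m ^+ 4 / 2 < A -> 0 < K -> K <= 4 * n ->
  ((1 + tau) * A < B ->
     (1 + tau / 2) * (A / K) <= B / K /\
     2 * B <= (B / K - (1 + tau / 2) * (A / K)) ^+ 2) /\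
  256 <= delta * (tau ^+ 2 * (A / K)).
Proof.
move=> n100 nm tau1 a0 atau d0 d1 md mA K0 K4.
have m0 : 0 < m by lra.
have n0 : 0 < n by lra.
have A0 : 0 < A by apply: le_lt_trans mA; rewrite divr_ge0 // exprn_ge0 // ltW.
split.
  move=> AB; have B0 : 0 < B by apply: lt_trans AB; rewrite mulr_gt0 //; lra.
  (* As [tau > 1], [1 + tau / 2 <= 3 / 4 * (1 + tau)]; the gap is then at least [B / (4 * K)]. *)
  have q : (1 + tau / 2) * A <= 3 / 4 * B by nra.
  have -> : B / K - (1 + tau / 2) * (A / K) = (B - (1 + tau / 2) * A) / K.
    by field; rewrite gt_eqF.
  rewrite mulrA ler_pM2r ?invr_gt0 //; split; first by lra.
  rewrite expr_div_n ler_pdivlMr ?exprn_gt0 //.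
  apply: le_trans (_ : (B / 4) ^+ 2 <= _); last by rewrite lerXn2r ?nnegrE; lra.
  (* Here [32 * K ^ 2 <= 512 * m ^ 2], while [B > 2 * A > m ^ 4 >= 10000 * m ^ 2]. *)
  suff : 32 * K ^+ 2 <= B by nra.
  have h1 : K ^+ 2 <= 16 * m ^+ 2 by nra.
  have h2 : 10000 <= m ^+ 2 by nra.
  have h3 : m ^+ 4 = m ^+ 2 * m ^+ 2 by ring.
  have h4 : 10000 * m ^+ 2 <= m ^+ 4 by rewrite h3; nra.
  have h5 : 2 * A < B by nra.
  by lra.
have ad0 : 0 < (a * delta) ^+ 2 by rewrite exprn_gt0 // mulr_gt0.
move: md; rewrite ler_pdivrMr // exprMn => md.
have a2 : a ^+ 2 <= tau ^+ 2 by nra.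
have d2 : delta ^+ 2 <= delta by nra.
(* Bounding [a] by [tau] and [delta ^ 2] by [delta] gives [n <= m * (tau ^ 2 * delta)]; with
   [A / K >= m ^ 3 / 8] the target is at least [n * m ^ 2 / 8]. *)
have h : n * (1 + tau) <= m * (tau ^+ 2 * delta).
  apply: le_trans md _; rewrite ler_pM2l // ler_pM ?sqr_ge0 //.
have h' : n <= m * (tau ^+ 2 * delta) by nra.
have AK : m ^+ 3 / 8 <= A / K.
  rewrite ler_pdivlMr //.
  have h3 : m ^+ 4 = m ^+ 3 * m by ring.
  have m3 : 0 < m ^+ 3 by rewrite exprn_gt0.
  have := ler_wpM2l (ltW m3) (le_trans K4 (_ : _ <= 4 * m)) => /(_ ltac:(lra)); lra.
have td : 0 <= tau ^+ 2 * delta by rewrite mulr_ge0 ?sqr_ge0 ?ltW.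
apply: le_trans (_ : tau ^+ 2 * delta * (m ^+ 3 / 8) <= _); last first.
  by have := ler_wpM2l td AK; lra.
have -> : tau ^+ 2 * delta * (m ^+ 3 / 8) = m * (tau ^+ 2 * delta) * (m ^+ 2 / 8) by field.
have m2 : 10000 <= m ^+ 2 by nra.
by nra.
Qed.

(** The first bound gives [2 ^ (t + k) <= 2 ^ (2 ^ k)], which permits [b = 2]; the second keeps the
    number of cells linear in [n]. *)
Lemma pow2_between (n t : nat) : (0 < n)%N -> (t <= n)%N ->
  exists2 k, (t + k <= 2 ^ k)%N & (2 ^ k <= 4 * n)%N.
Proof.
move=> n0 tn; have := @trunc_log_bounds 2 (2 * n) isT.
rewrite muln_gt0 n0 => /(_ isT); move: (trunc_log _ _) => j /andP[].
move=> a b; have h := ltn_expl j (isT : (1 < 2)%N).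
by exists j.+1; rewrite expnS in b *; move: (2 ^ j)%N a b h => e; lia.
Qed.

(** * Choice of [t] and comparison with the surjective maps *)

Theorem mainTheorem6 (R : realType) (n : nat) (S : {set 'rV['F_2]_n})
  (delta tau : R) :
  0 < delta -> delta <= 1 / 10 -> 1 < tau ->
  (#|S|%:R : R) >
    Num.max ((n%:R ^+ 4 * (1 + tau) ^+ 4) / ((tau - Num.sqrt tau) * delta) ^+ 8)
            (n%:R ^+ 4) ->
  (n%:R : R) >=
    20 * (Num.ceil (log2 (Num.max ((n%:R * (1 + tau)) / ((tau - Num.sqrt tau) * delta) ^+ 2)
                                  n%:R)))%:~R ->
  exists t : nat,
    (t <= n)%N /\
    (t%:R : R) >=
      log2 (#|S|%:R) - 4 * log2 (Num.max ((n%:R * (1 + tau)) /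
                                   ((tau - Num.sqrt tau) ^+ 2 * delta ^+ 2)) n%:R) /\
    (#|[set M : 'M['F_2]_(n, t) | surjectiveb M &
         `[< close_to_uniform S M (tau * 2 ^- t) >]]|%:R : R) >=
      (1 - delta) * #|[set M : 'M['F_2]_(n, t) | surjectiveb M]|%:R.
Proof.
move=> d0 d1 tau1 HS Hn.
set a := tau - Num.sqrt tau in HS Hn *.
have sq1 : 1 < Num.sqrt tau by rewrite -[X in X < _]sqrtr1 ltr_sqrt //; lra.
have sqE : Num.sqrt tau ^+ 2 = tau by rewrite sqr_sqrtr; lra.
have a0 : 0 < a by rewrite /a subr_gt0; nra.
have atau : a <= tau by rewrite /a; lra.
have ad0 : 0 < a * delta by rewrite mulr_gt0.
rewrite -exprMn; set m0 := _ / (a * delta) ^+ 2 in Hn *; set m := Num.max m0 _ in Hn *.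
have nm : n%:R <= m by rewrite le_max lexx orbT.
have m0m : m0 <= m by rewrite le_max lexx.
have m4S : m ^+ 4 < #|S|%:R.
  rewrite /m; have [_|_] := leP m0; first by move: HS; rewrite gt_max => /andP[].
  by move: HS; rewrite gt_max /m0 expr_div_n -exprM (exprMn _ n%:R) => /andP[].
have m_ge0 : 0 <= m by apply: le_trans nm.
have S0 : (0 < #|S|)%N by rewrite -(ltr_nat R); apply: le_lt_trans m4S; rewrite exprn_ge0.
have S0' : 0 < #|S|%:R :> R by rewrite ltr0n.
have Sn : #|S|%:R <= 2 ^+ n :> R.
  by rewrite -natrX ler_nat -card_rV_F2 max_card.
(* For [n <= 1] take [t = n]: a fibre has at most [#|S|] points and [2 ^ n <= 2 <= 1 + tau], so
   every map is close to uniform. *)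
have [n1|n2] := leqP n 1.
  exists n; split => //; split.
    have lS : log2 #|S|%:R <= n%:R :> R by apply: log2_le_nat.
    suff : 0 <= log2 m by lra.
    (* For [n = 0] also [m = 0], and [ln 0 = 0] by convention. *)
    have [n0|n0] := posnP n; last by apply: log2_ge0; apply: le_trans nm; rewrite ler1n.
    by rewrite /m /m0 n0 !mul0r maxxx /log2 ln0 // mul0r.
  set G := [set M | _ & _]; have -> : G = [set M : 'M['F_2]_n | surjectiveb M].
    apply/finset.setP => M; rewrite !inE; case: surjectiveb => //=.
    apply/asboolP; apply: close_to_uniform_load => // [|y]; first exact: ltW.
    apply: le_trans (_ : #|S|%:R <= _); first by rewrite ler_nat load_le_card.
    rewrite mulrCA ler_peMr // ler_pdivlMr ?exprn_gt0 // mul1r.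
    apply: le_trans (_ : 2 <= _); last by lra.
    by rewrite -natrX ler_nat (@leq_pexp2l 2 n 1).
  by rewrite ler_piMl //; lra.
have n100 : 100 <= n%:R :> R by apply: bootstrap_n_ge100 n2 nm Hn.
have m1 : 1 <= m by apply: le_trans nm; lra.
have m4 : 1 <= m ^+ 4 by rewrite exprn_ege1.
pose enough t := #|S|%:R <= 2 ^+ t * m ^+ 4.
have exn : exists t, enough t.
  by exists n; rewrite /enough (le_trans Sn) // ler_peMr // exprn_ge0.
case: (ex_minnP exn) => t tenough tmin.
have tn : (t <= n)%N by apply: tmin; rewrite /enough (le_trans Sn) // ler_peMr // exprn_ge0.
have t0 : (0 < t)%N.
  by case: t tenough {tmin tn} => //; rewrite /enough mul1r leNgt m4S.
(* By minimality [t - 1] violates [enough]; this yields [A > m ^ 4 / 2]. *)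
have tlt : 2 ^+ t * m ^+ 4 < 2 * #|S|%:R.
  rewrite -(prednK t0) exprS -mulrA ltr_pM2l // ltNge; apply/negP => /tmin.
  by rewrite leqNgt ltn_predL t0.
exists t; split => //; split.
  have lnat : log2 (#|S|%:R / m ^+ 4) <= t%:R :> R.
    apply: log2_le_nat; first by rewrite divr_gt0 // (lt_le_trans ltr01).
    by rewrite ler_pdivrMr // (lt_le_trans ltr01).
  apply: le_trans lnat; rewrite /log2 ln_div ?posrE //; last by apply: lt_le_trans m4.
  by rewrite lnXn ?(lt_le_trans ltr01) // -[ln m *+ 4]mulr_natl mulrBl mulrA.
have [k tk k4] := @pow2_between n t (ltnW n2) tn.
pose A : R := #|S|%:R / 2 ^+ t; pose K : R := 2 ^+ k.
have K0 : 0 < K by rewrite exprn_gt0.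
have T0 : 0 < 2 ^+ t :> R by rewrite exprn_gt0.
have mA : m ^+ 4 / 2 < A by rewrite /A ltr_pdivlMr //; lra.
have K4 : K <= 4 * n%:R by rewrite /K -natrX -natrM ler_nat.
have est := @parameter_estimates R n%:R m tau a delta A K _ n100 nm tau1 a0 atau d0 d1 m0m mA K0 K4.
have [_ est2] := est 0.
have A0 : 0 < A by rewrite divr_gt0.
pose beta := (1 + tau) * A.
have cT : #|{: 'rV['F_2]_(t + k)}|%:R = 2 ^+ t * K by rewrite card_rV_F2 natrX exprD.
have AK : #|S|%:R / (2 ^+ t * K) = A / K by rewrite invfM mulrA.
have AK0 : 0 < A / K by rewrite divr_gt0.
have beta0 : 0 <= beta by rewrite mulr_ge0 ?ltW //; lra.
have := @card_heavy_fibre R 'F_2 n t k S 2 ((1 + tau / 2) * (A / K)) beta (ler0n _ 2).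
rewrite cT AK card_rV_F2 natrX -/K; set heavy := [set M | _] => H.
have {}H : #|heavy|%:R * ((1 + tau / 2) * (A / K) - A / K) ^+ 2 <=
    8 * 2 * (A / K) * #|{: 'M['F_2]_(n, t)}|%:R.
  apply: H beta0 (fun B => proj1 (est B)).
    by rewrite -exprD -!natrX ler_nat leq_pexp2l.
  by rewrite ler_peMl ?(ltW AK0) //; lra.
have surj4 : #|{: 'M['F_2]_(n, t)}|%:R <=
    4 * #|[set M : 'M['F_2]_(n, t) | surjectiveb M]|%:R :> R.
  by rewrite -natrM ler_nat card_surjective_ge.
set G := [set M : 'M['F_2]_(n, t) | surjectiveb M &
  `[< close_to_uniform S M (tau * 2 ^- t) >]].
(* By [close_to_uniform_load], a surjective map outside [G] has a fibre above [beta]. *)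
have cover : (#|[set M : 'M['F_2]_(n, t) | surjectiveb M]| <= #|G| + #|heavy|)%N.
  apply: leq_trans (leq_card_setU G heavy); apply/subset_leq_card/fintype.subsetP => M.
  rewrite !inE => ->; apply: contraT; rewrite negb_or => /andP[/asboolP nclose nheavy].
  case: nclose; apply: close_to_uniform_load => // [|y]; first exact: ltW.
  rewrite leNgt; apply/negP => Hy; move/negP: nheavy; apply.
  by apply/fintype.existsP; exists y.
move: H surj4 cover; rewrite -(ler_nat R) natrD.
move: est2 AK0; clear -d0 tau1.
set X := A / K; set h := #|heavy|%:R; set Mt := #|{: _}|%:R; set g := #|G|%:R.
set u := #|[set M | surjectiveb M]|%:R => est2 X0 H surj4 cover.
have Mt0 : 0 <= Mt by apply: ler0n.
have Y0 : 0 < tau ^+ 2 * X by rewrite mulr_gt0 // exprn_gt0 //; lra.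
(* The squared gap is [tau ^ 2 * X ^ 2 / 4], whence [64 = 4 * 16]. Then [256 = 4 * 64] gives
   [4 * h <= delta * Mt], and this 4 absorbs the one in [surj4]. *)
have h1 : h * (tau ^+ 2 * X) <= 64 * Mt.
  rewrite -(ler_pM2r X0).
  have e : h * (tau ^+ 2 * X) * X = 4 * (h * ((1 + tau / 2) * X - X) ^+ 2) by field.
  by rewrite e; lra.
have h2 : 4 * h <= delta * Mt.
  rewrite -(ler_pM2r Y0); have := ler_wpM2r Mt0 est2; lra.
have := ler_wpM2l (ltW d0) surj4; lra.
Qed.
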